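(* Let $\delta\in(0,0.49)$, $\gamma\in(0,\tfrac12)$, let $n\in\mathbb{N}$ be sufficiently large, and let $s$ satisfy $n\le s\le O\!\left(\tfrac{2^n}{n}\right)$. Suppose there is a constant $\varepsilon>0$ such that $s\ge 1/\gamma^{2+\varepsilon}$. Then there exists a function $f:\{0,1\}^n\to\{0,1\}$ such that: (1) for every circuit $C$ of size at most $s$, $\Pr_{x\sim\{0,1\}^n}[C(x)=f(x)]\le 1-\delta$, where $x$ is uniform on $\{0,1\}^n$; and (2) for every probability distribution $H$ over $\{0,1\}^n$, there exists a circuit $C$ of size $O(s\gamma^2)$ such that $\Pr_{x\sim H}[C(x)=f(x)]\ge \tfrac12+\gamma$. (The constant implicit in $O(s\gamma^2)$ may depend on $\varepsilon$.)
   Context: Circuits have gates computing arbitrary Boolean functions of fan-in 2, arbitrary depth, and size is the number of gates. $x\sim H$ denotes a sample from the distribution $H$. *)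

(* Defs.v *)
From HB Require Import structures.
From mathcomp Require Import all_boot all_order all_algebra.
From mathcomp Require Import reals exp.

Set Implicit Arguments.
Unset Strict Implicit.
Unset Printing Implicit Defensive.

Import Order.TTheory GRing.Theory Num.Theory.
Local Open Scope ring_scope.

(* Circuits are straight-line programs.  Wires 0, ..., n-1 carry the inputs
   and wire n + i carries the value of the i-th gate; a gate may only read
   wires that precede it. *)
Record gate := Gate {
  gate_op : {ffun bool * bool -> bool};
  gate_in1 : nat;
  gate_in2 : nat
}.

Fixpoint wf_gates (k : nat) (gs : seq gate) : bool :=
  if gs is g :: gs' then
    [&& (gate_in1 g < k)%N, (gate_in2 g < k)%N & wf_gates k.+1 gs']
  else true.

Fixpoint run_gates (w : seq bool) (gs : seq gate) : seq bool :=
  if gs is g :: gs' then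
    let b := gate_op g (nth false w (gate_in1 g), nth false w (gate_in2 g)) in
    run_gates (rcons w b) gs'
  else w.

(* The output may be any wire, so a circuit without gates is a projection. *)
Record circuit (n : nat) := Circuit {
  gates : seq gate;
  output : nat;
  gates_wf : wf_gates n gates;
  output_wf : (output < n + size gates)%N
}.

Definition circuit_size (n : nat) (C : circuit n) : nat := size (gates C).

Definition circuit_eval (n : nat) (C : circuit n) (x : n.-tuple bool) : bool :=
  nth false (run_gates x (gates C)) (output C).

Record distribution (R : realType) (T : finType) := Distribution {
  pmf :> T -> R;
  pmf_ge0 : forall x, 0 <= pmf x;
  pmf_sum1 : \sum_x pmf x = 1
}.

Definition Pr (R : realType) (T : finType) (H : distribution R T)
    (A : pred T) : R :=
  \sum_(x | A x) H x.

Section Uniform.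
Variables (R : realType) (n : nat).

Let unif (_ : n.-tuple bool) : R := (2 ^+ n)^-1.

Fact uniform_ge0 x : 0 <= unif x.
Proof. by rewrite invr_ge0 exprn_ge0. Qed.

Fact uniform_sum1 : \sum_x unif x = 1.
Proof.
rewrite sumr_const card_tuple card_bool -[LHS]mulr_natr natrX mulVf //.
by rewrite expf_neq0 // pnatr_eq0.
Qed.

Definition uniform : distribution R (n.-tuple bool) :=
  Distribution uniform_ge0 uniform_sum1.

End Uniform.

(* Main.v *)
Require Import Defs.
From mathcomp Require Import all_boot all_order all_algebra.
From mathcomp Require Import reals exp.
From mathcomp Require Import ring lra zify.

(* Let [f] depend only on the first [m] input bits, where [2 ^ m] is about
   [s log s]; a Chernoff bound and a union bound over circuits make such an [f]
   hard for size [s].  No other property of [f] is needed for the predictors.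
   Cut the cube of the first [m] bits into blocks of about [1 / gamma ^ 2]
   points.  Random quadratic forms over F_2 are 4-wise independent signs, so by
   a fourth-moment argument, for any weights, some form xored into [f] makes the
   best constant on each block correct with advantage [gamma] on average.  A
   predictor is thus a function of the block index, which by Shannon's upper
   bound has circuits of size about [s gamma ^ 2 log s / log (s gamma ^ 2)],
   xored with a form of size [O(m ^ 2)].  The hypothesis
   [s >= 1 / gamma ^ (2 + eps)] makes both [O(s gamma ^ 2)]. *)

Set Implicit Arguments.
Unset Strict Implicit.
Unset Printing Implicit Defensive.

Import Order.TTheory GRing.Theory Num.Theory.
Local Open Scope ring_scope.

(** * Random quadratic forms *)

(** Diagonal pairs give the linear terms. If [(i, j)] and [(j, i)] both lie in [S] they cancel, so a
    uniform [S] still yields every form without constant term equally often. *)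
Definition quad {m : nat} (S : {set 'I_m * 'I_m}) (y : {ffun 'I_m -> bool}) :
    bool :=
  \big[addb/false]_(p in S) (y p.1 && y p.2).

(** The sum factors over [p] into [(-1) ^+ e p + 1], and a single true [e p] makes the product
    vanish. *)
Lemma sum_signr_set (R : numDomainType) (P : finType) (e : P -> bool) :
  \sum_(S : {set P}) \prod_(p in S) (-1) ^+ e p =
  if [forall p, ~~ e p] then #|{set P}|%:R else 0 :> R.
Proof.
case: ifPn => [/forallP e0 | /forallPn[p /negPn ep]].
  rewrite -sum1_card natr_sum; apply: eq_bigr => S _.
  by apply: big1 => p _; rewrite (negPf (e0 p)).
transitivity (\prod_p ((-1) ^+ e p + 1) : R); last first.
  by rewrite (bigD1 p) //= ep expr1 addNr mul0r.
by rewrite bigA_distr; apply: eq_bigr => S _; rewrite big_mkcond.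
Qed.

(* The quadratic monomials at four points cancel only if the points pair up:
   RM(m-3, m), the dual of the quadratic Reed-Muller code, has distance 8. *)
Lemma quad_pairing (I : finType) (a b c d : {ffun I -> bool}) :
  (forall i j,
     ~~ ((a i && a j) (+) (b i && b j) (+) (c i && c j) (+) (d i && d j))) ->
  [\/ a = b /\ c = d, a = c /\ b = d | a = d /\ b = c].
Proof.
move=> E; have [ab|/eqP ab] := eqVneq a b.
  constructor 1; split=> //; apply/ffunP => i; move: (E i i); rewrite ab.
  by case: (b i); case: (c i); case: (d i).
have [i0 abi]: exists i, a i != b i.
  by apply/existsP; apply: contra_notT ab => /existsPn ab; apply/ffunP => i;
    apply/eqP/negPn/ab.
(* Parity at [(i0, i0)] makes exactly one of [c], [d] agree with [a] at [i0]. The monomials at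
   [(i0, j)] see only the two points that are 1 at [i0] and equate them; those at [(j, j)] then
   equate the other two. *)
have [/eqP aci|/eqP aci] := eqVneq (a i0) (c i0).
  constructor 2; split; apply/ffunP => j; move: abi aci (E i0 i0) (E i0 j) (E j j);
  by case: (a i0); case: (b i0); case: (c i0); case: (d i0);
     case: (a j); case: (b j); case: (c j); case: (d j).
constructor 3; split; apply/ffunP => j; move: abi aci (E i0 i0) (E i0 j) (E j j);
  by case: (a i0); case: (b i0); case: (c i0); case: (d i0);
     case: (a j); case: (b j); case: (c j); case: (d j).
Qed.

(** * Second and fourth moments of signed sums *)

Section QuadMoments.
Variables (R : rcfType) (m : nat).
Implicit Types (S : {set 'I_m * 'I_m}) (y : {ffun 'I_m -> bool}).
Implicit Types u : {ffun 'I_m -> bool} -> R.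

Local Notation Q := (#|{set 'I_m * 'I_m}|%:R : R).

Lemma signr_quad S y :
  (-1) ^+ quad S y = \prod_(p in S) (-1) ^+ (y p.1 && y p.2) :> R.
Proof. by rewrite /quad (big_morph (fun e : bool => (-1) ^+ e : R) (@signr_addb R)
  (expr0 (-1) : (-1) ^+ false = 1)). Qed.

(** The product of the four signs is a character of [S], so its sum is [Q] or 0. Several pairings
    can hold at once, hence only an upper bound. The lower bound 0 later allows absolute values of
    the weights. *)
Lemma sum_signr_quad4 (a b c d : {ffun 'I_m -> bool}) :
  (0 : R) <= \sum_S (-1) ^+ quad S a * (-1) ^+ quad S b *
              ((-1) ^+ quad S c * (-1) ^+ quad S d) <=
  Q * ((a == b) && (c == d))%:R + Q * ((a == c) && (b == d))%:R
  + Q * ((a == d) && (b == c))%:R.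
Proof.
under eq_bigr do rewrite !signr_quad -!big_split /=.
under eq_bigr do under eq_bigr do rewrite -!signr_addb.
rewrite (sum_signr_set R (fun p : 'I_m * 'I_m =>
  ((a p.1 && a p.2) (+) (b p.1 && b p.2)) (+)
  ((c p.1 && c p.2) (+) (d p.1 && d p.2)))).
have Q0 : 0 <= Q by [].
case: ifPn => [/forallP E|_]; last by rewrite lexx !addr_ge0 ?mulr_ge0.
have {E} : forall i j, ~~ ((a i && a j) (+) (b i && b j) (+) (c i && c j)
    (+) (d i && d j)) by move=> i j; have := E (i, j); rewrite /= !addbA.
move=> /quad_pairing pairs; rewrite Q0 /=.
have {pairs}: [|| (a == b) && (c == d), (a == c) && (b == d) |
               (a == d) && (b == c)].
  by case: pairs => -[-> ->]; rewrite !eqxx ?orbT.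
by do 3 case: (_ && _) => //=; rewrite ?mulr1 ?mulr0; move: Q0; lra.
Qed.

Lemma sum_signr_quad2 (a b : {ffun 'I_m -> bool}) :
  \sum_S (-1) ^+ quad S a * (-1) ^+ quad S b = Q * (a == b)%:R :> R.
Proof.
under eq_bigr do rewrite !signr_quad -!big_split /=.
under eq_bigr do under eq_bigr do rewrite -!signr_addb.
rewrite (sum_signr_set R (fun p : 'I_m * 'I_m => (a p.1 && a p.2) (+)
  (b p.1 && b p.2))).
have [->|ab] := eqVneq a b.
  by rewrite mulr1 ifT //; apply/forallP => p; rewrite addbb.
rewrite mulr0 ifN //; apply: contra_neqN ab => /forallP E.
apply/ffunP => i; move: (E (i, i)) => /=.
by case: (a i); case: (b i).
Qed.

Lemma second_moment u :
  \sum_S (\sum_y u y * (-1) ^+ quad S y) ^+ 2 = Q * \sum_y u y ^+ 2.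
Proof.
under eq_bigr do rewrite expr2 big_distrlr.
rewrite exchange_big mulr_sumr; apply: eq_bigr => a _ /=.
rewrite exchange_big (bigD1 a) //= [X in _ + X]big1 ?addr0 => [|b ba].
  under eq_bigr do rewrite mulrACA -expr2.
  by rewrite -mulr_sumr sum_signr_quad2 eqxx mulr1 mulrC.
under eq_bigr do rewrite mulrACA.
by rewrite -mulr_sumr sum_signr_quad2 eq_sym (negPf ba) !mulr0.
Qed.

Lemma sum_eq_pairs (T : finType) (F : T -> T -> T -> T -> R) :
  \sum_a \sum_b \sum_c \sum_d F a b c d * ((a == b) && (c == d))%:R =
  \sum_a \sum_c F a a c c.
Proof.
apply: eq_bigr => a _; rewrite (bigD1 a) //= [X in _ + X]big1 ?addr0 => [|b ba].
  apply: eq_bigr => c _; rewrite (bigD1 c) //= !eqxx mulr1 big1 ?addr0 // => d dc.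
  by rewrite eq_sym (negPf dc) mulr0.
by rewrite big1 // => c _; rewrite big1 // => d _; rewrite eq_sym (negPf ba) mulr0.
Qed.

Lemma fourth_moment u :
  \sum_S (\sum_y u y * (-1) ^+ quad S y) ^+ 4 <=
  3 * Q * (\sum_y u y ^+ 2) ^+ 2.
Proof.
have E4 S : (\sum_y u y * (-1) ^+ quad S y) ^+ 4 =
  \sum_a \sum_b \sum_c \sum_d (u a * u b * (u c * u d)) *
   ((-1) ^+ quad S a * (-1) ^+ quad S b *
     ((-1) ^+ quad S c * (-1) ^+ quad S d)).
  rewrite (exprM _ 2 2) 2!expr2 big_distrlr big_distrl /=.
  apply: eq_bigr => a _; rewrite big_distrl; apply: eq_bigr => b _ /=.
  rewrite big_distrr; apply: eq_bigr => c _ /=.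
  rewrite big_distrr; apply: eq_bigr => d _ /=.
  by move: ((-1) ^+ quad S a) ((-1) ^+ quad S b) ((-1) ^+ quad S c)
    ((-1) ^+ quad S d) => ? ? ? ?; ring.
under eq_bigr do rewrite E4.
rewrite exchange_big.
under eq_bigr do rewrite exchange_big.
under eq_bigr do under eq_bigr do rewrite exchange_big.
under eq_bigr do under eq_bigr do under eq_bigr do rewrite exchange_big.
under eq_bigr do under eq_bigr do under eq_bigr do under eq_bigr do
  rewrite -mulr_sumr.
(* The four-point sums are nonnegative, so [u] may be replaced by its absolute value before they are
   bounded above. Each of the three pairings then contributes the same amount. *)
pose v a : R := `|u a|.
apply: (@le_trans _ _ (\sum_a \sum_b \sum_c \sum_d
  (v a * v b * (v c * v d) * (Q * ((a == b) && (c == d))%:R) +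
   v a * v b * (v c * v d) * (Q * ((a == c) && (b == d))%:R) +
   v a * v b * (v c * v d) * (Q * ((a == d) && (b == c))%:R)))).
  apply: ler_sum => a _; apply: ler_sum => b _.
  apply: ler_sum => c _; apply: ler_sum => d _.
  have /andP[E0 E1] := sum_signr_quad4 a b c d.
  rewrite -!mulrDr (le_trans (ler_wpM2r E0 (ler_norm _))) // !normrM.
  by apply: ler_wpM2l; rewrite ?mulr_ge0 ?normr_ge0 // !mulrDr.
have vv a : v a * v a = u a ^+ 2 by rewrite /v -normrM -expr2 ger0_norm ?sqr_ge0.
under eq_bigr do under eq_bigr do under eq_bigr do rewrite !big_split /=.
under eq_bigr do under eq_bigr do rewrite !big_split /=.
under eq_bigr do rewrite !big_split /=.
rewrite !big_split /=.
have T : Q * (\sum_y u y ^+ 2) ^+ 2 =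
    \sum_a \sum_b v a * v a * (v b * v b) * Q.
  rewrite mulrC expr2 big_distrlr mulr_suml; apply: eq_bigr => a _.
  by rewrite mulr_suml; apply: eq_bigr => b _; rewrite !vv.
have -> (x : R) : 3 * Q * x = Q * x + Q * x + Q * x by ring.
rewrite T.
rewrite le_eqVlt; apply/orP; left; apply/eqP; congr (_ + _ + _).
- under eq_bigr do under eq_bigr do under eq_bigr do under eq_bigr do
    rewrite mulrA.
  exact: sum_eq_pairs (fun a b c d => v a * v b * (v c * v d) * Q).
- under eq_bigr do rewrite exchange_big.
  under eq_bigr do under eq_bigr do under eq_bigr do under eq_bigr do
    rewrite mulrA [v _ * v _ * _]mulrACA.
  exact: sum_eq_pairs (fun a b c d => v a * v b * (v c * v d) * Q).
- under eq_bigr do under eq_bigr do rewrite exchange_big.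
  under eq_bigr do rewrite exchange_big.
  have swap a b c d e :
    v a * v b * (v c * v d) * (Q * e) = v a * v d * (v b * v c) * Q * e by ring.
  under eq_bigr do under eq_bigr do under eq_bigr do under eq_bigr do
    rewrite swap.
  exact: sum_eq_pairs (fun a b c d => v a * v b * (v c * v d) * Q).
Qed.
End QuadMoments.

(** A quartic minorant of the absolute value, tangent at [|x| = t]: with [y = |x|] and denominators
    cleared, the gap is [y * (y + 2 * t) * (y - t) ^+ 2 / 2]. It turns second and fourth moments
    into a lower bound on the first absolute moment. *)
Lemma ler_norm_quartic (R : rcfType) (x t : R) : 0 < t ->
  3 / 2 * (x ^+ 2 / t) - (x ^+ 4 / t ^+ 3) / 2 <= `|x|.
Proof.
move=> t0; rewrite -(real_normK (num_real x)) (exprM x 2 2) -(real_normK (num_real x)).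
rewrite -exprM.
have := normr_ge0 x; move: `|x| => y y0.
rewrite -(ler_pM2r (exprn_gt0 3 t0)).
have -> : (3 / 2 * (y ^+ 2 / t) - y ^+ (2 * 2) / t ^+ 3 / 2) * t ^+ 3 =
  (3 * y ^+ 2 * t ^+ 2 - y ^+ 4) / 2 by field; rewrite gt_eqF.
rewrite -subr_ge0.
have -> : y * t ^+ 3 - (3 * y ^+ 2 * t ^+ 2 - y ^+ 4) / 2 =
  y * (y + 2 * t) * (y - t) ^+ 2 / 2 by field.
have t0' := ltW t0.
by rewrite divr_ge0 // mulr_ge0 ?sqr_ge0 // mulr_ge0 // addr_ge0 // mulr_ge0.
Qed.

Lemma first_moment_quad (R : rcfType) m (u : {ffun 'I_m -> bool} -> R) (W : R) :
  0 <= W -> W ^+ 2 <= 3 * \sum_y u y ^+ 2 ->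
  #|{set 'I_m * 'I_m}|%:R * (W / 3) <=
    \sum_(S : {set 'I_m * 'I_m}) `|\sum_y u y * (-1) ^+ quad S y|.
Proof.
set w := \sum_y _ => W0 Ww.
have w0 : 0 <= w by apply: sumr_ge0 => y _; apply: sqr_ge0.
have [->|Wn0] := eqVneq W 0; first by rewrite mul0r mulr0 sumr_ge0.
(* This [t] maximizes the resulting bound [3 w / (2 t) - 3 w ^ 2 / (2 t ^ 3)], whose value becomes
   [t / 3]. *)
pose t := Num.sqrt (3 * w).
have t2 : t ^+ 2 = 3 * w by rewrite sqr_sqrtr // mulr_ge0.
have Wt : W <= t by rewrite -ler_sqr ?nnegrE ?sqrtr_ge0 // t2.
have t0 : 0 < t by apply: lt_le_trans Wt; rewrite lt_def Wn0.
apply: le_trans (ler_sum _ (fun S _ => ler_norm_quartic _ t0)).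
rewrite big_split sumrN /= -mulr_sumr -!mulr_suml second_moment -/w.
have := fourth_moment u; rewrite -/w; set M := \sum_S _ => M4.
have tE : w = t ^+ 2 / 3 by rewrite t2 mulrC mulKf // pnatr_eq0.
have Q0 : 0 <= #|{set 'I_m * 'I_m}|%:R :> R by [].
move: M4; rewrite tE; move: {+}#|_|%:R Q0 => Q Q0 M4.
apply: (@le_trans _ _ (Q * (t / 3))).
  by rewrite ler_wpM2l // ler_pM2r ?invr_gt0.
apply: (@le_trans _ _ (3 / 2 * (Q * (t ^+ 2 / 3) / t) -
    3 * Q * (t ^+ 2 / 3) ^+ 2 / t ^+ 3 / 2)).
  by rewrite le_eqVlt; apply/orP; left; apply/eqP; field; rewrite gt_eqF.
by rewrite lerD2l lerN2 ler_pM2r ?invr_gt0 // ler_pM2r ?invr_gt0 ?exprn_gt0.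
Qed.

(** Cauchy-Schwarz against the constant 1. *)
Lemma sqr_sum_le (R : realFieldType) (I : finType) (P : pred I) (F : I -> R) :
  (\sum_(i | P i) F i) ^+ 2 <= #|P|%:R * \sum_(i | P i) F i ^+ 2.
Proof.
rewrite expr2 big_distrlr /=.
apply: (@le_trans _ _ (\sum_(i | P i) \sum_(j | P j) 2^-1 * (F i ^+ 2 + F j ^+ 2))).
  apply: ler_sum => i _; apply: ler_sum => j _.
  have := sqr_ge0 (F i - F j); nra.
under [leLHS]eq_bigr do rewrite -mulr_sumr big_split /= sumr_const.
rewrite -mulr_sumr big_split sumr_const /= sumrMnl mulr_natl.
by rewrite le_eqVlt; apply/orP; left; apply/eqP; move: (_ *+ #|_|) => T; field.
Qed.

(* Whatever the weights, on each block a random quadratic form makes one of the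
   two constants about as good as for uniform weights and random signs. *)
Lemma quad_block_advantage (R : rcfType) m b (Z : finType)
    (rho : {ffun 'I_m -> bool} -> Z) (w : {ffun 'I_m -> bool} -> R)
    (sg : {ffun 'I_m -> bool} -> bool) (g : R) :
  (forall z, #|[pred y | rho y == z]| <= b)%N ->
  (forall y, 0 <= w y) -> \sum_y w y = 1 -> 0 <= g -> 12 * b%:R * g ^+ 2 <= 1 ->
  exists (S : {set 'I_m * 'I_m}) (h : Z -> bool),
    2 * g <= \sum_y w y * (-1) ^+ (sg y (+) h (rho y) (+) quad S y).
Proof.
move=> cardb w0 w1 g0 gb.
pose u z y := if rho y == z then w y * (-1) ^+ sg y else 0.
pose X S z := \sum_y u z y * (-1) ^+ quad S y.
have uw z : \sum_y u z y ^+ 2 = \sum_(y | rho y == z) w y ^+ 2.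
  rewrite [RHS]big_mkcond; apply: eq_bigr => y _; rewrite /u.
  by case: ifP => _; rewrite ?expr0n // exprMn sqrr_sign mulr1.
pose W z := \sum_(y | rho y == z) w y.
have W0 z : 0 <= W z by apply: sumr_ge0.
have CS z : W z ^+ 2 <= b%:R * \sum_(y | rho y == z) w y ^+ 2.
  apply: le_trans (sqr_sum_le _ _) _.
  rewrite ler_wpM2r ?ler_nat ?cardb // sumr_ge0 // => y _; exact: sqr_ge0.
have EX z : #|{set 'I_m * 'I_m}|%:R * (2 * g * W z) <= \sum_S `|X S z|.
  (* [first_moment_quad] is applied to [6 * g * W z]; since 36 = 12 * 3, its hypothesis follows from
     [CS] and [12 * b * g ^ 2 <= 1]. *)
  have -> : 2 * g * W z = 6 * g * W z / 3 by field.
  apply: first_moment_quad; first by rewrite !mulr_ge0.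
  rewrite uw; apply: le_trans (_ : 12 * b%:R * g ^+ 2 * (3 * \sum_(y | rho y == z) w y ^+ 2) <= _).
    have -> : (6 * g * W z) ^+ 2 = 36 * g ^+ 2 * W z ^+ 2 by ring.
    apply: le_trans (ler_wpM2l _ (CS z)) _; first by rewrite mulr_ge0 ?sqr_ge0.
    by rewrite le_eqVlt; apply/orP; left; apply/eqP; ring.
  rewrite -[leRHS]mul1r ler_wpM2r // mulr_ge0 // sumr_ge0 // => y _.
  exact: sqr_ge0.
(* Summed over all blocks, the average over forms is at least [2 * g], so one form serves all blocks
   together. *)
have [S HS] : exists S, 2 * g <= \sum_z `|X S z|.
  apply/existsP; apply: contraT => /existsPn E.
  have : \sum_S \sum_z `|X S z| < \sum_(S : {set 'I_m * 'I_m}) 2 * g.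
    apply: ltr_sum; last by move=> S _; rewrite ltNge.
    by apply/hasP; exists set0; rewrite ?mem_index_enum.
  rewrite ltNge sumr_const -[_ *+ #|_|]mulr_natl exchange_big /=.
  have -> : 2 * g = \sum_z 2 * g * W z.
    rewrite -mulr_sumr -[LHS]mulr1 -w1; congr (_ * _).
    by rewrite (partition_big rho xpredT).
  by rewrite mulr_sumr ler_sum.
(* Flipping exactly the blocks with negative correlation turns each [X S z] into its absolute
   value. *)
exists S, (fun z => X S z < 0); apply: le_trans HS _.
rewrite le_eqVlt; apply/orP; left; apply/eqP.
rewrite [RHS](partition_big rho xpredT) //=; apply: eq_bigr => z _.
transitivity (X S z * (-1) ^+ (X S z < 0)%R).
  by case: (ltrP (X S z) 0) => ?; rewrite /= ?expr0 ?expr1 ?mulr1 ?mulrN1;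
    [rewrite ltr0_norm | rewrite ger0_norm].
rewrite /X mulr_suml [RHS]big_mkcond; apply: eq_bigr => y _; rewrite /u.
case: eqP => [->|_]; last by rewrite !mul0r.
by rewrite !signr_addb -!mulrA; congr (_ * _); rewrite mulrCA mulrC -!mulrA; congr (_ * _); rewrite mulrC.
Qed.

(** * Circuit upper bounds *)

Section Chains.
Local Open Scope nat_scope.
Variable X : finType.
Local Notation bfun := {ffun X -> bool}.
Implicit Types (A B D E : {set bfun}) (f g : bfun).

(** Straight-line programs without wire numbers: a state is the set of functions computed so far, so
    programs compose by inclusion and values are shared freely. *)
Inductive chain A : nat -> {set bfun} -> Prop :=
| chain0 : chain A 0 A
| chainS k B (op : {ffun bool * bool -> bool}) f g :
    chain A k B -> f \in B -> g \in B ->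
    chain A k.+1 ([ffun x => op (f x, g x)] |: B).

(** Allowing fewer gates and extra functions makes this monotone in all three arguments. *)
Definition cost A k D := exists j B, [/\ j <= k, chain A j B & D \subset B].

Lemma chain_trans A B D k l : chain A k B -> chain B l D -> chain A (k + l) D.
Proof.
move=> AB; elim=> [|j D' op f g _ IH fD gD]; first by rewrite addn0.
by rewrite addnS; apply: chainS.
Qed.

Lemma chain_mono A A' B k : chain A k B -> A \subset A' ->
  exists2 B', chain A' k B' & A' :|: B \subset B'.
Proof.
move=> AB AA'; elim: AB => [|j D op f g _ [B' AB' sub] fD gD].
  by exists A'; [exact: chain0 | rewrite subUset subxx].
have {}sub : (A' \subset B') /\ (D \subset B') by apply/andP; rewrite -subUset.
exists ([ffun x => op (f x, g x)] |: B').
  by apply: chainS => //; apply: (subsetP sub.2).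
by rewrite !subUset sub1set setU11 !(subset_trans _ (subsetUr _ _)) ?sub.1 ?sub.2.
Qed.

Lemma chain_sub A B k : chain A k B -> A \subset B.
Proof.
elim=> [|j D op f g _ IH _ _]; first exact: subxx.
exact: subset_trans IH (subsetUr _ _).
Qed.

Lemma cost_weaken A A' D D' k k' : cost A k D -> A \subset A' ->
  D' \subset D -> k <= k' -> cost A' k' D'.
Proof.
move=> [j [B [jk /chain_mono AB DB]]] /AB [B' AB']; rewrite subUset => /andP[_ BB'].
move=> DD' kk'; exists j, B'; split=> //; first exact: leq_trans jk kk'.
exact: subset_trans (subset_trans DD' DB) BB'.
Qed.

Lemma cost_trans A D E k l : cost A k D -> cost (A :|: D) l E ->
  cost A (k + l) (D :|: E).
Proof.
move=> [j [B [jk AB DB]]] [j' [C [jl /chain_mono AD EC]]].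
have [|C' BC'] := AD B; first by rewrite subUset DB (chain_sub AB).
rewrite subUset => /andP[BC CC'].
exists (j + j'), C'; split; [exact: leq_add | exact: chain_trans BC' |].
by rewrite subUset (subset_trans DB) // (subset_trans EC).
Qed.

Lemma cost0 A D : D \subset A -> cost A 0 D.
Proof. by move=> DA; exists 0, A; split=> //; apply: chain0. Qed.

Lemma cost_gate (op : bool -> bool -> bool) A D k f g :
  cost A k D -> f \in A :|: D -> g \in A :|: D ->
  cost A k.+1 ([ffun x => op (f x) (g x)] |: D).
Proof.
move=> AD fD gD; rewrite -addn1 setUC; apply: cost_trans AD _.
pose op' := [ffun p : bool * bool => op p.1 p.2].
exists 1, ([ffun x => op' (f x, g x)] |: (A :|: D)); split=> //.
  by apply: chainS fD gD; apply: chain0.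
by rewrite sub1set; apply/setU1P; left; apply/ffunP => x; rewrite !ffunE.
Qed.

Lemma cost_each A D k : (forall f, f \in D -> cost A k [set f]) ->
  cost A (#|D| * k) D.
Proof.
move: {2}#|D| (erefl #|D|) => c; elim: c D => [|c IH] D cD costD.
  by move/eqP: cD; rewrite cards_eq0 => /eqP ->; rewrite cards0; apply: cost0; apply: sub0set.
have /card_gt0P[f fD] : 0 < #|D| by rewrite cD.
rewrite -(setD1K fD) cardsU1 setD11 /= mulnDl mul1n; apply: cost_trans.
  exact: costD.
apply: cost_weaken (subsetUl _ _) (subxx _) (leqnn _); apply: IH.
  by move: cD; rewrite (cardsD1 f) fD => -[].
by move=> g /setD1P[_ /costD].
Qed.

(** Even a constant gate must read some wire; [f] supplies it. *)
Lemma cost_const A b f : f \in A -> cost A 1 [set [ffun=> b]].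
Proof.
move=> fA.
have := cost_gate (fun _ _ => b) (f := f) (g := f) (cost0 (sub0set A)).
rewrite inE fA => /(_ isT isT) c; apply: cost_weaken c (subxx _) _ (leqnn _).
by rewrite sub1set; apply/setU1P; left; apply/ffunP => x; rewrite !ffunE.
Qed.

Lemma cost_mux A v f g : v \in A -> f \in A -> g \in A ->
  cost A 3 [set [ffun x => if v x then f x else g x]].
Proof.
move=> vA fA gA.
pose p : bfun := [ffun x => v x && f x].
pose q : bfun := [ffun x => ~~ v x && g x].
have cp : cost A 1 (p |: set0).
  by apply: (cost_gate andb); rewrite ?setU0 //; apply: cost0; apply: sub0set.
have cq : cost A 2 (q |: (p |: set0)).
  by apply: (cost_gate (fun a b => ~~ a && b)); rewrite // in_setU ?vA ?gA.
have := cost_gate orb cq.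
move=> /(_ p q); rewrite !inE !eqxx !orbT => /(_ isT isT) cpq.
apply: cost_weaken cpq (subxx _) _ (leqnn _).
rewrite sub1set; apply/setU1P; left; apply/ffunP => x; rewrite !ffunE.
by case: (v x); rewrite ?orbF.
Qed.

(** A full binary decision tree has [2 ^ t - 1] inner nodes, each a multiplexer of 3 gates. Leaves
    are functions rather than constants, so they may depend on further variables. *)
Lemma cost_mux_tree t (v : nat -> bfun) A (F : seq bool -> bfun) :
  (forall i, i < t -> v i \in A) ->
  (forall bs, size bs = t -> F bs \in A) ->
  cost A (3 * (2 ^ t).-1) [set [ffun x => F [seq v i x | i <- iota 0 t] x]].
Proof.
elim: t v F => [|t IH] v F vA FA.
  apply: cost0; rewrite sub1set.
  suff -> : [ffun x => F [seq v i x | i <- iota 0 0] x] = F [::] by apply: FA.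
  by apply/ffunP => x; rewrite ffunE.
pose G b : bfun :=
  [ffun x => F (b :: [seq v i.+1 x | i <- iota 0 t]) x].
have costG b : cost A (3 * (2 ^ t).-1) [set G b].
  apply: (IH (fun i => v i.+1) (fun bs => F (b :: bs))) => [i it|bs bst].
    exact: vA.
  by apply: FA; rewrite /= bst.
have costGG : cost A (3 * (2 ^ t).-1 + 3 * (2 ^ t).-1) ([set G true] :|: [set G false]).
  by apply: cost_trans => //; apply: cost_weaken (costG _) (subsetUl _ _) (subxx _) _.
have -> : 3 * (2 ^ t.+1).-1 = 3 * (2 ^ t).-1 + 3 * (2 ^ t).-1 + 3.
  have := expn_gt0 2 t; rewrite expnS; lia.
have cF : cost (A :|: ([set G true] :|: [set G false])) 3
   [set [ffun x => if v 0 x then G true x else G false x]].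
  by apply: cost_mux; rewrite !inE ?vA ?eqxx ?orbT.
apply: cost_weaken (cost_trans costGG cF) (subxx _) _ (leqnn _).
apply: subset_trans (subsetUr _ _); rewrite sub1set; apply/set1P/ffunP => x.
rewrite !ffunE /= (iotaDl 1 0) -map_comp.
by case: (v 0 x).
Qed.

(* Shannon: the last [j] variables are served by a table of all functions of
   them, the first [t] by a tree of multiplexers. *)
Lemma cost_shannon t j (v : nat -> bfun) A (G : seq bool -> bool) :
  0 < t + j -> (forall i, i < t + j -> v i \in A) ->
  cost A (2 + 2 ^ (2 ^ j) * (3 * 2 ^ j) + 3 * 2 ^ t)
    [set [ffun x => G [seq v i x | i <- iota 0 (t + j)]]].
Proof.
move=> tj vA.
have cC : cost A 2 ([set [ffun=> true]] :|: [set [ffun=> false]]).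
  apply: (cost_trans (k := 1) (l := 1)); first exact: cost_const (vA 0 tj).
  by apply: (cost_const _ (f := v 0)); rewrite inE vA.
set C := _ :|: _ in cC.
pose V := [set [ffun x => P [ffun i : 'I_j => v (t + i) x]]
  | P : {ffun {ffun 'I_j -> bool} -> bool}] : {set bfun}.
have cardV : #|V| <= 2 ^ (2 ^ j).
  apply: leq_trans (leq_imset_card _ _) _.
  by rewrite card_ffun card_bool card_ffun card_bool card_ord.
have cV : cost (A :|: C) (#|V| * (3 * 2 ^ j)) V.
  apply: cost_each => _ /imsetP[P _ ->].
  apply: (cost_weaken (cost_mux_tree (t := j) (v := fun i => v (t + i))
    (A := A :|: C)
    (F := fun bs => [ffun=> P [ffun i : 'I_j => nth false bs i]]) _ _)).
  - by move=> i ij; rewrite inE vA ?ltn_add2l.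
  - by move=> bs _; rewrite !inE; case: (P _); rewrite eqxx ?orbT.
  - exact: subxx.
  - rewrite sub1set; apply/set1P/ffunP => x; rewrite !ffunE.
    congr (P _); apply/ffunP => i; rewrite !ffunE.
    by rewrite (nth_map 0) ?size_iota // nth_iota.
  - by rewrite leq_mul2l leq_pred.
have cCV := cost_trans cC cV.
have cT : cost (A :|: (C :|: V)) (3 * (2 ^ t).-1)
    [set [ffun x => G [seq v i x | i <- iota 0 (t + j)]]].
  apply: (cost_weaken (cost_mux_tree (t := t) (v := v)
    (A := A :|: (C :|: V)) (F := fun bs =>
      [ffun x => G (bs ++ [seq v i x | i <- iota t j])]) _ _)) => //.
  - by move=> i it; rewrite inE vA // ltn_addr.
  (* Once the prefix [bs] is fixed, [G] depends only on the last [j] variables, so this leaf is in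
     the table [V]. *)
  - move=> bs _; rewrite !inE; apply/orP; right; apply/orP; right.
    apply/imsetP; exists [ffun y : {ffun 'I_j -> bool} => G (bs ++ codom y)] => //.
    apply/ffunP => x; rewrite !ffunE; congr (G (_ ++ _)).
    apply: (@eq_from_nth _ false); rewrite size_map size_iota ?size_codom ?card_ord //.
    move=> i ij; rewrite (nth_map 0) ?size_iota // nth_iota //.
    rewrite -[i]/(val (Ordinal ij)) -[X in X = _](ffunE (fun i : 'I_j => v (t + i) x)).
    by rewrite (nth_map (Ordinal ij)) ?size_enum_ord // nth_ord_enum.
  - rewrite sub1set; apply/set1P/ffunP => x; rewrite !ffunE.
    by rewrite iotaD map_cat.
apply: cost_weaken (cost_trans cCV cT) (subxx _) (subsetUr _ _) _.
by rewrite !leq_add // ?leq_mul // leq_pred.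
Qed.

(** Two gates per term, and one for the constant that starts the sum. *)
Lemma cost_xor_and (I : Type) (s : seq I) (v w : I -> bfun) A f :
  f \in A -> (forall i, v i \in A /\ w i \in A) ->
  cost A (2 * size s + 1) [set [ffun x => \big[addb/false]_(i <- s) (v i x && w i x)]].
Proof.
move=> fA vwA; elim: s => [|i s IH].
  apply: cost_weaken (cost_const false fA) (subxx _) _ (leqnn _).
  by rewrite sub1set; apply/set1P/ffunP => x; rewrite !ffunE big_nil.
pose p : bfun := [ffun x => v i x && w i x].
have [vA wA] := vwA i.
have c1 := cost_gate andb (f := v i) (g := w i) IH.
rewrite !inE vA wA in c1; move: (c1 isT isT) => {}c1.
pose h : bfun := [ffun x => \big[addb/false]_(i <- s) (v i x && w i x)].
have := cost_gate addb (f := p) (g := h) c1.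
rewrite !inE !eqxx !orbT => /(_ isT isT) c2.
apply: cost_weaken c2 (subxx _) _ _; last by rewrite /=; lia.
rewrite sub1set; apply/setU1P; left; apply/ffunP => x.
by rewrite !ffunE big_cons.
Qed.

End Chains.

(** * From chains to circuits *)

Section Realize.
Local Open Scope nat_scope.

Lemma run_gates_cat w gs hs :
  run_gates w (gs ++ hs) = run_gates (run_gates w gs) hs.
Proof. by elim: gs w => [|g gs IH] w //=. Qed.

Lemma size_run_gates w gs : size (run_gates w gs) = size w + size gs.
Proof.
elim: gs w => [|g gs IH] w /=; first by rewrite addn0.
by rewrite IH size_rcons addSnnS.
Qed.

Lemma nth_run_gates w gs i : i < size w ->
  nth false (run_gates w gs) i = nth false w i.
Proof.
elim: gs w => [|g gs IH] w //= iw.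
by rewrite IH ?size_rcons ?nth_rcons ?iw // ltnS ltnW.
Qed.

Lemma wf_gates_cat k gs hs :
  wf_gates k (gs ++ hs) = wf_gates k gs && wf_gates (k + size gs) hs.
Proof.
elim: gs k => [|g gs IH] k /=; first by rewrite addn0.
by rewrite IH -!andbA addSnnS.
Qed.

Definition inputs n : {set {ffun n.-tuple bool -> bool}} :=
  [set [ffun x : n.-tuple bool => tnth x i] | i : 'I_n].

(** Each function of the chain is assigned a wire; a new gate lands on wire [n + k], and appending
    it leaves earlier wires unchanged. *)
Lemma chain_gates n k (B : {set {ffun n.-tuple bool -> bool}}) :
  chain (inputs n) k B ->
  exists gs, [/\ wf_gates n gs, size gs = k &
    forall f, f \in B -> exists2 i, i < n + k &
      forall x : n.-tuple bool, nth false (run_gates x gs) i = f x].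
Proof.
elim=> [|{}k {}B op f g _ [gs [wf sz holds]] fB gB].
  exists [::]; split=> // _ /imsetP[i _ ->]; exists i; first by rewrite addn0.
  by move=> x; rewrite ffunE (tnth_nth false).
have [i ik fi] := holds f fB; have [j jk gj] := holds g gB.
exists (gs ++ [:: Gate op i j]); split.
- by rewrite wf_gates_cat wf /= sz ik jk.
- by rewrite size_cat sz addn1.
move=> h /setU1P[->|/holds[l lk hl]].
  exists (n + k) => [|x]; first by rewrite addnS.
  rewrite run_gates_cat /= nth_rcons size_run_gates size_tuple sz ltnn eqxx.
  by rewrite fi gj ffunE.
exists l => [|x]; first by rewrite addnS ltnW.
by rewrite run_gates_cat nth_run_gates ?size_run_gates ?size_tuple ?sz.
Qed.

Lemma cost_circuit n k (f : {ffun n.-tuple bool -> bool}) :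
  cost (inputs n) k [set f] ->
  exists C : circuit n, circuit_size C <= k /\ forall x, circuit_eval C x = f x.
Proof.
move=> [j [B [jk /chain_gates[gs [wf sz holds]] fB]]].
have [|i ij fi] := holds f; first by rewrite -sub1set.
rewrite -sz in ij; exists (Circuit wf ij); split=> //.
by rewrite /circuit_size sz.
Qed.

End Realize.

(** * Functions hard on average *)

Lemma bernoulli_ineq (R : realFieldType) (h : R) n :
  -1 <= h -> 1 + n%:R * h <= (1 + h) ^+ n.
Proof.
move=> h1; elim: n => [|n IH]; first by rewrite mul0r addr0 expr0.
have h0 : 0 <= 1 + h by rewrite addrC -lerBlDr sub0r.
rewrite exprS; apply: le_trans (ler_wpM2l h0 IH).
have := sqr_ge0 h; have : 0 <= n%:R :> R by [].
rewrite -natr1; nra.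
Qed.

(** Compared with the proportion [p : q], the right side trades [e] factors [1 - x <= 1] for [e]
    factors [1 + x >= 1]. Integer powers on both sides avoid fractional exponents. *)
Lemma weight_agreements_le (R : realFieldType) (x : R) p q N a :
  0 <= x <= 1 -> (p * N <= (p + q) * a)%N -> (a <= N)%N ->
  ((1 + x) ^+ p * (1 - x) ^+ q) ^+ N <=
    ((1 + x) ^+ a * (1 - x) ^+ (N - a)) ^+ (p + q).
Proof.
case/andP=> x0 x1 paN aN.
rewrite exprMn [leRHS]exprMn -!exprM.
have [e e1 e2] : exists2 e, (a * (p + q) = p * N + e)%N &
    (q * N = (N - a) * (p + q) + e)%N.
  by exists (a * (p + q) - p * N)%N; nia.
have y0 : 0 <= 1 - x by lra.
have z0 : 0 <= 1 + x by lra.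
rewrite e1 e2 !exprD mulrA [leRHS]mulrAC.
apply: ler_pM; rewrite ?mulr_ge0 ?exprn_ge0 //.
by apply: (@le_trans _ _ 1); [apply: exprn_ile1 | apply: exprn_ege1]; lra.
Qed.

(* The exponential weights [(1 + x)^agreements (1 - x)^disagreements] average
   to 1 over all [phi], and with [x = 1/50] they are large as soon as 51% of the
   points agree. *)
Lemma exists_unpredictable (R : realFieldType) (Y T : finType)
    (g : T -> Y -> bool) :
  #|T|%:R ^+ 100 < (10196 / 10000 : R) ^+ #|Y| ->
  exists phi : {ffun Y -> bool},
    forall t, (100 * #|[pred y | g t y == phi y]| <= 51 * #|Y|)%N.
Proof.
set kap : R := 10196 / 10000 => smallT.
pose x : R := 1 / 50.
have x01 : 0 <= x <= 1 by rewrite /x; lra.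
have kap0 : 0 <= kap by rewrite /kap; lra.
pose wt t (phi : {ffun Y -> bool}) : R :=
  \prod_y (1 + x * (-1) ^+ (g t y (+) phi y)).
have term_ge0 (e : bool) : 0 <= 1 + x * (-1) ^+ e.
  by rewrite /x; case: e; rewrite ?expr0 ?expr1; lra.
have wt_ge0 t phi : 0 <= wt t phi by apply: prodr_ge0.
have sum_wt t : \sum_phi wt t phi = \sum_(phi : {ffun Y -> bool}) 1.
  rewrite -(bigA_distr_bigA (fun y b => 1 + x * (-1) ^+ (g t y (+) b))).
  rewrite (eq_bigr (fun=> 2)) => [|y _].
    by rewrite prodr_const sumr_const card_ffun card_bool natrX.
  by rewrite big_bool; case: (g t y); rewrite /= ?expr0 ?expr1; ring.
(* Pairing 49 factors of each kind leaves [(1 + x) ^ 2 * (1 - x ^ 2) ^ 49], to which Bernoulli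
   applies. *)
have kapE : kap <= (1 + x) ^+ 51 * (1 - x) ^+ 49.
  have -> : (1 + x) ^+ 51 * (1 - x) ^+ 49 =
      (1 + x) ^+ 2 * (1 + - x ^+ 2) ^+ 49.
    have -> : 1 + - x ^+ 2 = (1 + x) * (1 - x) by ring.
    by rewrite exprMn [RHS]mulrA -(exprD (1 + x) 2 49).
  apply: le_trans (ler_wpM2l (sqr_ge0 _) (bernoulli_ineq 49 _)).
    by rewrite /kap /x; lra.
  by rewrite /x; lra.
have wt_large t (phi : {ffun Y -> bool}) : (51 * #|Y| < 100 * #|[pred y | g t y == phi y]|)%N ->
    #|T|%:R < wt t phi.
  set a := #|_| => aY.
  have aleY : (a <= #|Y|)%N := max_card _.
  have wtE : wt t phi = (1 + x) ^+ a * (1 - x) ^+ (#|Y| - a).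
    rewrite /wt (bigID (fun y => g t y == phi y)) /=; congr (_ * _).
      rewrite -[RHS]prodr_const; apply: eq_big => // y /eqP ->.
      by rewrite addbb expr0 mulr1.
    rewrite -(cardC [pred y | g t y == phi y]) addKn -[RHS]prodr_const; apply: eq_big => // y.
    by case: (g t y); case: (phi y) => //= _; rewrite expr1 mulrN1.
  rewrite -(@ltr_pXn2r _ 100) ?nnegrE ?wt_ge0 //.
  apply: lt_le_trans smallT _; rewrite wtE.
  apply: le_trans (weight_agreements_le (p := 51) (q := 49) x01 (ltnW aY) aleY).
  by apply: (lerXn2r _ _ _ kapE); rewrite nnegrE // (le_trans kap0).
suff /existsP[phi /forallP good] : [exists phi : {ffun Y -> bool}, forall t,
    (100 * #|[pred y | g t y == phi y]| <= 51 * #|Y|)%N] by exists phi.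
apply: contraT => /existsPn bad.
(* If every [phi] were predicted by some [t], the weights summed over [t] would exceed [#|T|] at
   every [phi], against their average 1 for each [t]. *)
have : \sum_(phi : {ffun Y -> bool}) #|T|%:R <
    \sum_(phi : {ffun Y -> bool}) \sum_t wt t phi.
  apply: ltr_sum => [|phi _].
    by apply/hasP; exists [ffun=> true]; rewrite ?mem_index_enum.
  have /forallPn[t] := bad phi; rewrite -ltnNge => /wt_large lt_wt.
  by apply: lt_le_trans lt_wt _; rewrite (bigD1 t) //= lerDl sumr_ge0.
rewrite exchange_big /=; under [ltRHS]eq_bigr do rewrite sum_wt.
by rewrite !sumr_const -!mulrnA mulnC ltxx.
Qed.

(** * Averaging over the settings of the remaining bits *)

Section FirstBits.
Local Open Scope nat_scope.
Variables (n m : nat).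
Hypothesis le_mn : m <= n.
Implicit Types (x : n.-tuple bool) (y : {ffun 'I_m -> bool}).

Definition first_bits x : {ffun 'I_m -> bool} := [ffun i : 'I_m => nth false x i].

Definition set_first_bits y x : n.-tuple bool :=
  [tuple oapp y (tnth x i) (insub (val i)) | i < n].

Lemma set_first_bitsK y x : first_bits (set_first_bits y x) = y.
Proof.
apply/ffunP => i; rewrite ffunE.
have lt_in := leq_trans (ltn_ord i) le_mn.
by rewrite -[val i]/(val (Ordinal lt_in)) -tnth_nth tnth_mktuple /= valK.
Qed.

Lemma set_first_bits_swap y x :
  set_first_bits (first_bits x) (set_first_bits y x) = x.
Proof.
apply: eq_from_tnth => i; rewrite !tnth_mktuple.
by case: insubP => [j _ ji|_] //=; rewrite ffunE ji -tnth_nth.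
Qed.

(** Exchanging [y] with the first [m] bits of [x] is an involution on pairs. Hence the fiber counts,
    summed over all [x], count each point of [P] exactly [2 ^ m] times. *)
Lemma card_le_fibers (P : pred (n.-tuple bool)) k l :
  (forall x, l * #|[pred y | P (set_first_bits y x)]| <= k * 2 ^ m) ->
  l * #|P| <= k * 2 ^ n.
Proof.
move=> fib; rewrite -(leq_pmul2r (_ : 0 < 2 ^ m)) ?expn_gt0 //.
pose swap (p : {ffun 'I_m -> bool} * n.-tuple bool) :=
  (first_bits p.2, set_first_bits p.1 p.2).
have swapK : involutive swap.
  by case=> y x; rewrite /swap /= set_first_bitsK set_first_bits_swap.
have cardm : #|{ffun 'I_m -> bool}| = 2 ^ m.
  by rewrite card_ffun card_bool card_ord.
have E : #|P| * 2 ^ m = \sum_x #|[pred y | P (set_first_bits y x)]|.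
  transitivity (\sum_(p : {ffun 'I_m -> bool} * n.-tuple bool) P p.2).
    rewrite -(pair_bigA _ (fun y x => P x : nat)) /= sum_nat_const cardm mulnC.
    by rewrite -sum1_card big_mkcond.
  rewrite (reindex_inj (inv_inj swapK)) /=.
  rewrite -(pair_bigA _ (fun y x => P (set_first_bits y x) : nat)) exchange_big /=.
  by apply: eq_bigr => x _; rewrite -sum1_card [RHS]big_mkcond.
rewrite -mulnA E big_distrr -mulnA mulnCA /=.
have -> : 2 ^ n = #|{: n.-tuple bool}| by rewrite card_tuple card_bool.
rewrite -sum_nat_const; exact: leq_sum.
Qed.

End FirstBits.

(** * Counting circuits *)

Section CircuitCodes.
Local Open Scope nat_scope.
Variables (n s : nat).

(** Well-formedness is dropped: decoding is total, with [false] read from missing wires, and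
    overcounting is harmless in a union bound. *)
Definition gate_code : finType :=
  ({ffun bool * bool -> bool} * 'I_(n + s) * 'I_(n + s))%type.

Definition circuit_code : finType := (s.-tuple gate_code * 'I_(n + s))%type.

Definition decode_gate (c : gate_code) : gate := Gate c.1.1 c.1.2 c.2.

Definition decode_eval (c : circuit_code) (x : n.-tuple bool) : bool :=
  nth false (run_gates x (map decode_gate c.1)) c.2.

Lemma card_circuit_code : #|circuit_code| = (16 * (n + s) ^ 2) ^ s * (n + s).
Proof.
rewrite !card_prod card_tuple !card_prod card_ord card_ffun card_prod card_bool.
by rewrite -mulnA.
Qed.

Lemma wf_gates_bound k gs : wf_gates k gs ->
  all (fun g => (gate_in1 g < k + size gs) && (gate_in2 g < k + size gs)) gs.
Proof.
elim: gs k => [|g gs IH] k //= /and3P[g1 g2 /IH].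
by rewrite addSnnS => ->; rewrite !ltn_addr.
Qed.

Lemma circuit_has_code (C : circuit n) : circuit_size C <= s ->
  exists c, decode_eval c =1 circuit_eval C.
Proof.
case: C => gs o wf lto; rewrite /circuit_size /= => szC.
have o_lt : o < n + s by apply: leq_trans lto _; rewrite leq_add2l.
have ns : 0 < n + s := leq_ltn_trans (leq0n o) o_lt.
have ops : exists cs : seq gate_code, map decode_gate cs = gs.
  have : all (fun g => (gate_in1 g < n + s) && (gate_in2 g < n + s)) gs.
    apply: sub_all (wf_gates_bound wf) => g /andP[g1 g2].
    by rewrite (leq_trans g1) ?(leq_trans g2) ?leq_add2l.
  elim: (gs) => [|[op i j] gs' IH] /=; first by exists [::].
  move=> /andP[/andP[ilt jlt] /IH[cs <-]].
  by exists ((op, Ordinal ilt, Ordinal jlt) :: cs).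
have [cs csE] := ops.
(* Padding goes at the end, so the output wire keeps its value. *)
pose dummy : gate_code := ([ffun=> false], Ordinal ns, Ordinal ns).
have szp : size (cs ++ nseq (s - size cs) dummy) == s.
  by rewrite size_cat size_nseq subnKC // -(size_map decode_gate) csE.
exists (Tuple szp, Ordinal o_lt) => x.
rewrite /decode_eval /circuit_eval /= map_cat csE run_gates_cat.
by rewrite nth_run_gates // size_run_gates size_tuple.
Qed.

End CircuitCodes.

(** The tests are circuits with the bits beyond the first [m] fixed. A [phi] that defeats all of
    them on the [m]-cube is hard on every fiber, hence on the whole cube. *)
Lemma exists_hard_function (R : realType) n m s L :
  (0 < n)%N -> (n <= s)%N -> (m <= n)%N -> (0 < L)%N -> (s <= 2 ^ L)%N ->
  (2 ^ 16 * (L * s) <= 2 ^ m)%N ->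
  exists phi : {ffun 'I_m -> bool} -> bool,
    forall C : circuit n, (circuit_size C <= s)%N ->
      Pr (uniform R n) (fun x => circuit_eval C x == phi (first_bits m x)) <=
        51 / 100.
Proof.
move=> n0 ns mn L0 sL Lm.
pose T : finType := (circuit_code n s * n.-tuple bool)%type.
pose g (t : T) (y : {ffun 'I_m -> bool}) := decode_eval t.1 (set_first_bits y t.2).
(* The exponent is [(2 * L + 6) * s + (L + 1) + n], and [L + 1 + n <= 3 * (L * s)]. *)
have cardT : (#|T| <= 2 ^ (11 * (L * s)))%N.
  rewrite card_prod card_circuit_code card_tuple card_bool.
  have nsL : (n + s <= 2 ^ L.+1)%N by rewrite expnS; lia.
  have nsL2 : (16 * (n + s) ^ 2 <= 2 ^ (2 * L + 6))%N.
    rewrite (_ : 2 * L + 6 = 4 + (L.+1) * 2)%N; last by lia.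
    by rewrite expnD expnM leq_mul // leq_sqr.
  apply: leq_trans (_ : 2 ^ ((2 * L + 6) * s) * 2 ^ L.+1 * 2 ^ n <= _)%N.
    by rewrite expnM !leq_mul // leq_exp2r //; lia.
  by rewrite -!expnD leq_exp2l //; nia.
have [|phi hphi] := @exists_unpredictable R _ _ g.
  rewrite card_ffun card_bool card_ord.
  apply: le_lt_trans (_ : (2 : R) ^+ (1100 * (L * s)) < _).
    rewrite (_ : 1100 * (L * s) = (11 * (L * s)) * 100)%N; last by lia.
    by rewrite [leRHS]exprM lerXn2r ?nnegrE ?exprn_ge0 // -natrX ler_nat.
  apply: lt_le_trans (_ : (2 : R) ^+ (1101 * (L * s)) <= _).
    by rewrite ltr_eXn2l ?ltr1n // ltn_mul2r; nia.
  (* Bernoulli gives [1.0196 ^ 52 >= 2], and [52 * 1101 = 57252] is below [2 ^ 16]. *)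
  apply: le_trans (_ : (10196 / 10000 : R) ^+ (52 * (1101 * (L * s))) <= _).
    rewrite [leRHS]exprM lerXn2r ?nnegrE ?exprn_ge0 //; first by lra.
    have -> : (10196 / 10000 : R) = 1 + 196 / 10000 by field.
    apply: le_trans (bernoulli_ineq 52 _); lra.
  by rewrite ler_weXn2l //; [lra | lia].
exists phi => C szC; have [c cE] := circuit_has_code szC.
rewrite /Pr /uniform /= sumr_const.
set A := #|_|.
have hA : (100 * A <= 51 * 2 ^ n)%N.
  apply: (card_le_fibers mn) => x; have := hphi (c, x).
  rewrite card_ffun card_bool card_ord; congr (_ <= _)%N; congr (_ * _)%N.
  by apply: eq_card => y; rewrite !inE /g cE /= set_first_bitsK.
rewrite -[leLHS]mulr_natl ler_pdivrMr ?exprn_gt0 //.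
have : (100 * A)%:R <= (51 * 2 ^ n)%:R :> R by rewrite ler_nat.
by rewrite !natrM natrX; lra.
Qed.

(** * Predictors *)

Lemma sqr_le_exp2 a : (a ^ 2 <= 2 * 2 ^ a)%N.
Proof.
elim: a => // a IH.
have [a3|] := leqP 3 a; last by case: a {IH} => [|[|[|]]].
have : (3 * a <= a * a)%N by rewrite leq_mul2r a3 orbT.
move: IH; rewrite (expnS 2 a) -!mulnn (mulSn a) (mulnS a); move: (a * a)%N (2 ^ a)%N => b P; lia.
Qed.

(** Shannon's bound [O(2 ^ r / r)]: with [2 ^ j] between [r / 4] and [r / 2], there are at most
    [2 ^ (r / 2)] table entries and the tree of size [3 * 2 ^ (r - j)] dominates. *)
Lemma cost_bits (X : finType) r (v : nat -> {ffun X -> bool})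
    (A : {set {ffun X -> bool}})    (G : seq bool -> bool) :
  (1 < r)%N -> (forall i, (i < r)%N -> v i \in A) ->
  exists2 u, (r * u <= 38 * 2 ^ r)%N &
    cost A u [set [ffun x => G [seq v i x | i <- iota 0 r]]].
Proof.
move=> r1 vA; have [j jr rj] : exists2 j, (2 * 2 ^ j <= r)%N & (r < 4 * 2 ^ j)%N.
  have l0 : (0 < trunc_log 2 r)%N by rewrite trunc_log_gt0.
  exists (trunc_log 2 r).-1; last have := trunc_log_ltn r (isT : 1 < 2)%N.
    by rewrite -expnS prednK // trunc_logP // ltnW.
  by rewrite -{1}(prednK l0) !expnS mulnA.
have jr' : (j <= r)%N.
  by have := ltn_expl j (isT : (1 < 2)%N); lia.
set t := (r - j)%N; have rE : r = (t + j)%N by rewrite /t subnK.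
exists (2 + 2 ^ (2 ^ j) * (3 * 2 ^ j) + 3 * 2 ^ t)%N; last first.
  by rewrite {1}rE; apply: cost_shannon => [|i]; rewrite -rE; [exact: ltnW | exact: vA].
have r2 : (2 ^ r = 2 ^ t * 2 ^ j)%N by rewrite {1}rE expnD.
have rlt : (r < 2 ^ r)%N by apply: ltn_expl.
have sq := sqr_le_exp2 (2 ^ j).
have le2 : (2 ^ (2 ^ j) * 2 ^ (2 ^ j) <= 2 ^ r)%N.
  by rewrite -expnD leq_exp2l // addnn -mul2n.
move: r2 rlt sq le2 jr rj; move: (2 ^ (2 ^ j))%N => B.
move: (2 ^ j)%N (2 ^ t)%N (2 ^ r)%N => a T N NE rN sq BN ar ra.
(* The three summands contribute 2, 24 and 12, whence 38. *)
have h1 : (r * T <= 4 * N)%N by rewrite NE; nia.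
have h2 : (r * (B * a) <= 8 * N)%N.
  apply: (@leq_trans (4 * a * (B * a))%N); first by rewrite leq_mul2r ltnW ?orbT.
  rewrite (_ : 4 * a * (B * a) = 4 * B * a ^ 2)%N; last by ring.
  apply: (@leq_trans (4 * B * (2 * B))%N); first by rewrite leq_mul2l sq orbT.
  by rewrite (_ : 4 * B * (2 * B) = 8 * (B * B))%N ?leq_mul2l //; ring.
nia.
Qed.

(** Indexed by [nat] to match the variable families [v] of the cost lemmas; only indices below [n]
    denote inputs. *)
Definition bit n (i : nat) : {ffun n.-tuple bool -> bool} :=
  [ffun x : n.-tuple bool => nth false x i].

Lemma bit_inputs n i : (i < n)%N -> bit n i \in inputs n.
Proof.
move=> lt_in; apply/imsetP; exists (Ordinal lt_in) => //.
by apply/ffunP => x; rewrite !ffunE (tnth_nth false).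
Qed.

Lemma cost_first_bits n r (h : {ffun 'I_r -> bool} -> bool) :
  (1 < r <= n)%N ->
  exists2 u, (r * u <= 38 * 2 ^ r)%N &
    cost (inputs n) u [set [ffun x => h (first_bits r x)]].
Proof.
case/andP=> r1 rn.
have [|u ru c] := @cost_bits _ r (bit n) (inputs n)
  (fun bs => h [ffun i : 'I_r => nth false bs i]) r1.
  by move=> i ir; apply: bit_inputs; apply: leq_trans rn.
exists u => //; apply: cost_weaken c (subxx _) _ (leqnn _).
rewrite sub1set; apply/set1P/ffunP => x; rewrite !ffunE; congr (h _).
apply/ffunP => i; rewrite !ffunE (nth_map 0) ?size_iota // nth_iota //.
by rewrite ffunE.
Qed.

Lemma cost_quad n m (S : {set 'I_m * 'I_m}) : (0 < m <= n)%N ->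
  cost (inputs n) (2 * m ^ 2 + 1) [set [ffun x => quad S (first_bits m x)]].
Proof.
case/andP=> m0 mn.
have bitA (i : 'I_m) : bit n i \in inputs n.
  by apply: bit_inputs; apply: leq_trans (ltn_ord i) mn.
have c := @cost_xor_and _ _ (enum S) (fun p => bit n p.1) (fun p => bit n p.2)
  (inputs n) (bit n (Ordinal m0)) (bitA _) (fun p => conj (bitA p.1) (bitA p.2)).
apply: cost_weaken c (subxx _) _ _.
  rewrite sub1set; apply/set1P/ffunP => x; rewrite !ffunE big_enum.
  by apply: eq_bigr => p _; rewrite !ffunE.
rewrite leq_add2r leq_mul2l -cardE /= -mulnn.
by apply: leq_trans (max_card _) _; rewrite card_prod card_ord.
Qed.

Lemma Pr_agree (R : realType) (T : finType) (H : distribution R T)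
    (a b : T -> bool) :
  Pr H (fun x => a x == b x) =
  1 / 2 + (\sum_x H x * (-1) ^+ (b x (+) a x)) / 2.
Proof.
have -> : 1 / 2 = (\sum_x H x) / 2 :> R by rewrite pmf_sum1.
rewrite /Pr -mulrDl -big_split mulr_suml big_mkcond /=.
apply: eq_bigr => x _.
by case: (a x); case: (b x); rewrite /= ?expr0 ?expr1; field.
Qed.

(** A block consists of the [2 ^ k] points sharing their first [r] bits. For [k = 0] the circuit
    computes [phi] itself, which covers [g] too large for the block argument. *)
Lemma weak_predictor (R : realType) n m r k (phi : {ffun 'I_m -> bool} -> bool)
    (H : distribution R (n.-tuple bool)) (g : R) :
  m = (r + k)%N -> (m <= n)%N -> (1 < r)%N -> 0 <= g <= 1 / 2 ->
  k = 0 \/ 12 * (2 ^ k)%:R * g ^+ 2 <= 1 ->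
  exists u (C : circuit n),
    [/\ (r * u <= 38 * 2 ^ r)%N, (circuit_size C <= u + (2 * m ^ 2 + 2))%N &
      1 / 2 + g <= Pr H (fun x => circuit_eval C x == phi (first_bits m x))].
Proof.
move=> mE; move: phi; rewrite mE {mE} => phi mn r1 /andP[g0 g1] [k0|gk].
  have [|u ru c] := @cost_first_bits n (r + k) phi; first by rewrite mn k0 addn0 r1.
  have [C [szC evC]] := cost_circuit c; exists u, C; split.
  - by move: ru; rewrite {1 2}k0 addn0.
  - exact: leq_trans szC (leq_addr _ _).
  rewrite Pr_agree.
  under eq_bigr do rewrite evC ffunE addbb expr0 mulr1.
  by rewrite pmf_sum1; lra.
pose rho (y : {ffun 'I_(r + k) -> bool}) : {ffun 'I_r -> bool} :=
  [ffun i => y (lshift k i)].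
(* The weights are the marginal of [H] on the first [m] bits. *)
pose w y := \sum_(x | first_bits (r + k) x == y) H x.
have sum_w F : \sum_x H x * F (first_bits (r + k) x) = \sum_y w y * F y.
  rewrite (partition_big (first_bits (r + k)) xpredT) //=.
  apply: eq_bigr => y _; rewrite mulr_suml.
  by apply: eq_bigr => x /eqP ->.
have card_fiber z : (#|[pred y | rho y == z]| <= 2 ^ k)%N.
  pose tail (y : {ffun 'I_(r + k) -> bool}) : {ffun 'I_k -> bool} :=
    [ffun i => y (rshift r i)].
  have inj : {in [pred y | rho y == z] &, injective tail}.
    move=> y y'; rewrite !inE => /eqP <- /eqP rr /ffunP tt; apply/ffunP => i.
    rewrite -(splitK i); case: (split i) => j /=.
      by move/ffunP/(_ j): rr; rewrite !ffunE.
    by move: (tt j); rewrite !ffunE.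
  rewrite -(card_in_image inj); apply: leq_trans (max_card _) _.
  by rewrite card_ffun card_bool card_ord.
have w0 y : 0 <= w y by apply: sumr_ge0 => x _; apply: pmf_ge0.
have w1 : \sum_y w y = 1.
  rewrite -(pmf_sum1 H) (partition_big (first_bits (r + k)) xpredT) //=.
have [S [h adv]] := quad_block_advantage phi card_fiber w0 w1 g0 gk.
have [|u ru cu] := @cost_first_bits n r h.
  by rewrite r1 (leq_trans _ mn) // leq_addr.
have cq := cost_quad S (n := n); rewrite mn addn_gt0 (ltnW r1) in cq.
move: cq => /(_ isT) cq.
pose f1 : {ffun n.-tuple bool -> bool} := [ffun x => h (first_bits r x)].
pose f2 : {ffun n.-tuple bool -> bool} := [ffun x => quad S (first_bits (r + k) x)].
have cuq : cost (inputs n) (u + (2 * (r + k) ^ 2 + 1)) ([set f1] :|: [set f2]).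
  by apply: cost_trans cu (cost_weaken cq (subsetUl _ _) (subxx _) (leqnn _)).
have := cost_gate addb (f := f1) (g := f2) cuq.
rewrite !inE !eqxx !orbT => /(_ isT isT) cx.
have {}cx : cost (inputs n) (u + (2 * (r + k) ^ 2 + 2))
    [set [ffun x => f1 x (+) f2 x]].
  by apply: cost_weaken cx (subxx _) _ _; rewrite ?sub1set ?setU11 // !addnS.
have [C [szC evC]] := cost_circuit cx; exists u, C; split => //.
rewrite Pr_agree lerD2l ler_pdivlMr // mulrC; apply: le_trans adv _.
rewrite -(sum_w (fun y => (-1) ^+ (phi y (+) h (rho y) (+) quad S y))).
rewrite le_eqVlt; apply/orP; left; apply/eqP; apply: eq_bigr => x _.
rewrite evC !ffunE addbA; congr (_ * _ ^+ (_ (+) h _ (+) _)).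
by apply/ffunP => i; rewrite !ffunE.
Qed.

(** Take the least [k] with [24 * 2 ^ k * P >= 1]; minimality gives the factor 12 unless [k = 0].
    Then [2 ^ (k (q + 1)) <= P ^ -(q + 1) <= s ^ q], so [k] stays a constant fraction below [L]. *)
Lemma exists_block_exponent (R : archiRealFieldType) (P : R) q s L :
  0 < P <= 1 -> (0 < q)%N -> (s <= 2 ^ L)%N -> 1 <= s%:R ^+ q * P ^+ q.+1 ->
  exists k, [/\ k = 0 \/ 12 * (2 ^ k)%:R * P <= 1, 1 <= 24 * (2 ^ k)%:R * P &
    (k * q.+1 <= L * q)%N].
Proof.
case/andP=> P0 P1 q0 sL sP.
have ex : exists k, 1 <= 24 * (2 ^ k)%:R * P.
  exists (Num.bound P^-1).
  rewrite -ler_pdivrMr // div1r; apply: le_trans (ltW (archi_boundP _)) _.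
    by rewrite invr_ge0 ltW.
  rewrite -natrM ler_nat.
  have := ltn_expl (Num.bound P^-1) (isT : (1 < 2)%N).
  by move: (Num.bound _) => b; move: (2 ^ b)%N => B; lia.
have [k kP kmin] := ex_minnP ex; exists k.
have [k00|k0] := posnP k; first by split; [left | | rewrite k00].
have kP' : 12 * (2 ^ k)%:R * P <= 1.
  have : ~~ (1 <= 24 * (2 ^ k.-1)%:R * P).
    by apply/negP => /kmin; rewrite leqNgt prednK // leqnn.
  rewrite -{2}(prednK k0) expnS natrM -ltNge => /ltW.
  by apply: le_trans; rewrite le_eqVlt; apply/orP; left; apply/eqP; ring.
split=> //; first by right.
rewrite -(leq_exp2l _ _ (isT : (1 < 2)%N)) !expnM.
apply: (@leq_trans (s ^ q)%N); last by rewrite leq_exp2r.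
rewrite -(ler_nat R) !natrX -(ler_pM2r (exprn_gt0 q.+1 P0)); apply: le_trans sP.
rewrite -exprMn -natrX; apply: exprn_ile1; first by rewrite mulr_ge0 // ltW.
apply: le_trans kP'; rewrite -mulrA ler_peMl ?mulr_ge0 ?(ltW P0) //.
by rewrite ler1n.
Qed.

(** With [d = L - k], the bound on [k] gives [L <= (q + 1) d]. As [d <= r], dividing by [r] cancels
    the factor [L] in [2 ^ m]. For the quadratic form, [m ^ 2] is at most a constant times [d ^ 2],
    which [2 ^ d] absorbs, and [2 ^ d * 2 ^ k = 2 ^ L <= 2 s]. *)
Lemma predictor_size_bound A s L L2 q k m r u :
  (2 ^ L <= 2 * s)%N -> (2 ^ L2 <= 2 * L)%N ->
  (L2 <= L)%N -> (0 < L)%N -> (k * q.+1 <= L * q)%N ->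
  m = (16 + L + L2)%N -> m = (r + k)%N -> (2 ^ 16 <= A)%N ->
  (r * u <= 38 * 2 ^ r)%N ->
  ((u + (2 * m ^ 2 + 2)) * 2 ^ k <= 256 * A * q.+1 ^ 2 * s)%N.
Proof.
move=> Ls L2L L2le L0 kq mE mr A16 ru.
have A50 : (50 <= A)%N.
  apply: leq_trans A16; apply: (leq_trans (isT : 50 <= 2 ^ 6)%N).
  by rewrite leq_exp2l.
have [d dE] : exists d, L = (d + k)%N by exists (L - k)%N; nia.
have Ld : (L <= q.+1 * d)%N by nia.
have dr : (d <= r)%N by lia.
have r0 : (0 < r)%N by lia.
have qq : (q.+1 <= q.+1 ^ 2)%N by rewrite -mulnn; nia.
have h1 : (u * 2 ^ k <= 152 * A * q.+1 * s)%N.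
  rewrite -(leq_pmul2l r0) mulnA.
  apply: (@leq_trans (38 * 2 ^ m)%N).
    by rewrite mr expnD mulnA leq_mul2r ru orbT.
  rewrite mE !expnD.
  apply: (@leq_trans (38 * (A * (2 * s) * (2 * L)))%N).
    by rewrite leq_mul2l; apply/orP; right; rewrite !leq_mul.
  apply: (@leq_trans (38 * (A * (2 * s) * (2 * (q.+1 * r))))%N); last by nia.
  by rewrite !leq_mul // (leq_trans Ld) // leq_mul.
have h2 : (m ^ 2 * 2 ^ k <= 1296 * q.+1 ^ 2 * s)%N.
  have m18 : (m <= 18 * (q.+1 * d))%N by lia.
  have dd := sqr_le_exp2 d.
  apply: (@leq_trans ((18 * (q.+1 * d)) ^ 2 * 2 ^ k)%N).
    by rewrite leq_mul // leq_sqr.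
  rewrite !expnMn.
  apply: (@leq_trans (18 ^ 2 * (q.+1 ^ 2 * (2 * 2 ^ d)) * 2 ^ k)%N).
    by rewrite leq_mul2r leq_mul2l leq_mul2l dd !orbT.
  move: Ls; rewrite dE expnD; move: (2 ^ d)%N (2 ^ k)%N (q.+1 ^ 2)%N => D B Q DB.
  have -> : (18 ^ 2 * (Q * (2 * D)) * B = 648 * (Q * (D * B)))%N by ring.
  have -> : (1296 * Q * s = 648 * (Q * (2 * s)))%N by ring.
  by rewrite !leq_mul2l DB !orbT.
have m1 : (1 <= m ^ 2)%N by rewrite expn_gt0; lia.
have h3 : (q.+1 * s <= q.+1 ^ 2 * s)%N by rewrite leq_mul.
have h4 : (50 * (q.+1 ^ 2 * s) <= A * (q.+1 ^ 2 * s))%N by rewrite leq_mul.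
have h5 : (A * (q.+1 * s) <= A * (q.+1 ^ 2 * s))%N by rewrite leq_mul.
(* Since [1 <= m ^ 2], the form costs at most [4 * 1296 = 5184] units, less than [104 * A] as
   [A >= 50]; and [152 + 104 = 256]. *)
move: h1 h2 m1 h3 h4 h5.
move: (2 ^ k)%N (m ^ 2)%N (q.+1 ^ 2)%N => B Q m2; nia.
Qed.

Theorem theorem1p4 (R : realType) :
  exists (c : R) (n0 : nat), 0 < c /\
  forall eps : R, 0 < eps ->
  exists K : R, 0 < K /\
  forall (delta gamma : R) (n s : nat),
    0 < delta < 49 / 100 ->
    0 < gamma < 1 / 2 ->
    (n0 <= n)%N ->
    (n <= s)%N ->
    s%:R <= c * (2 ^+ n / n%:R) ->
    1 / (gamma `^ (2 + eps)) <= s%:R ->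
  exists f : n.-tuple bool -> bool,
    (forall C : circuit n, (circuit_size C <= s)%N ->
       Pr (uniform R n) (fun x => circuit_eval C x == f x) <= 1 - delta)
    /\
    (forall H : distribution R (n.-tuple bool),
       exists C : circuit n,
         (circuit_size C)%:R <= K * (s%:R * gamma ^+ 2) /\
         1 / 2 + gamma <= Pr H (fun x => circuit_eval C x == f x)).
Proof.
(* [2 ^ m] will be at most [2 ^ 18 * s * L], so this constant ensures [m <= n]. *)
exists (2 ^- 18), 1%N; split=> [|eps eps0]; first by rewrite invr_gt0 exprn_gt0.
(* [q * eps > 2] makes [(2 + eps) * q] exceed [2 * (q + 1)], so that
   [s ^ q >= gamma ^ -(2 (q + 1))]. *)
set q := Num.bound (2 / eps).
have q2 : 2 < q%:R * eps.
  by rewrite -ltr_pdivrMr //; apply: archi_boundP; rewrite divr_ge0 // ltW.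
have q0 : (0 < q)%N.
  by case: (q) q2 => //; rewrite mul0r => /(lt_trans (ltr0Sn _ _)); rewrite ltxx.
set A := (2 ^ 16)%N.
exists (24 * (256 * A * q.+1 ^ 2)%:R); split.
  by rewrite mulr_gt0 // ltr0n !muln_gt0 !expn_gt0.
move=> delta gamma n s /andP[_ delta1] /andP[g0 g1] n1 ns sn gs.
have s0 : (0 < s)%N := leq_trans n1 ns.
have nR0 : 0 < n%:R :> R by rewrite ltr0n.
have sn' : (2 ^ 18 * (s * n) <= 2 ^ n)%N.
  rewrite -(ler_nat R) !natrM !natrX; move: sn.
  by rewrite [_ * (_ / _)]mulrA ler_pdivlMr // ler_pdivlMl ?exprn_gt0.
set L := (trunc_log 2 s).+1.
have sL : (s < 2 ^ L)%N by apply: trunc_log_ltn.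
have Ls : (2 ^ L <= 2 * s)%N by rewrite expnS leq_mul2l trunc_logP.
set L2 := (trunc_log 2 L).+1.
have LL2 : (L < 2 ^ L2)%N by apply: trunc_log_ltn.
have L2L : (2 ^ L2 <= 2 * L)%N by rewrite expnS leq_mul2l trunc_logP.
have L2le : (L2 <= L)%N.
  by apply: leq_trans (ltn_expl _ (isT : (1 < 2)%N)) (trunc_logP _ _).
(* This puts [2 ^ m] between [2 ^ 16 * L * s], needed for hardness, and four times that. *)
pose m := (16 + L + L2)%N.
have Ln : (L <= n)%N.
  rewrite /L -(ltn_exp2l _ _ (isT : (1 < 2)%N)).
  apply: leq_ltn_trans (trunc_logP (isT : (1 < 2)%N) s0) _.
  apply: leq_trans sn'.
  have : (2 ^ 1 * (s * n) <= 2 ^ 18 * (s * n))%N by rewrite leq_mul2r leq_exp2l ?orbT.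
  apply: leq_trans; rewrite expn1; have := leq_pmulr s n1.
  by move: (s * n)%N s0 => sn0; lia.
have mn : (m <= n)%N.
  rewrite -(leq_exp2l _ _ (isT : (1 < 2)%N)); apply: leq_trans sn'.
  rewrite (expnD 2 16 2) /m !expnD -/A.
  apply: (@leq_trans (A * (2 * s) * (2 * L))%N); first by rewrite !leq_mul.
  rewrite (_ : A * (2 * s) * (2 * L) = A * 2 ^ 2 * (s * L))%N.
    by rewrite !leq_mul2l Ln !orbT.
  by move: (A) => A'; ring.
have Am : (A * (L * s) <= 2 ^ m)%N.
  by rewrite /m !expnD -/A -mulnA leq_mul2l (mulnC L) leq_mul ?orbT // ltnW.
have [phi hard] := exists_hard_function R n1 ns mn (ltn0Sn _) (ltnW sL) Am.
exists (fun x => phi (first_bits m x)); split=> [C /hard|H]; first by lra.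
have P0 : 0 < gamma ^+ 2 <= 1.
  by rewrite exprn_gt0 //= exprn_ile1; lra.
have sP : 1 <= s%:R ^+ q * (gamma ^+ 2) ^+ q.+1.
  have y0 : 0 < gamma `^ (2 + eps) by apply: powR_gt0.
  move: gs; rewrite ler_pdivrMr // => /(exprn_ege1 q); rewrite exprMn.
  move/le_trans; apply; apply: ler_wpM2l; first by rewrite exprn_ge0.
  rewrite -exprM -!powR_mulrn ?powR_ge0 ?(ltW g0) //.
  rewrite -powRrM; apply: ger_powR; first by rewrite g0; lra.
  by rewrite natrM -natr1; move: q2; lra.
have [k [gk kg kq]] := exists_block_exponent P0 q0 (ltnW sL) sP.
have kL : (k < L)%N.
  by rewrite -(ltn_pmul2r (ltn0Sn q)) (leq_ltn_trans kq) // ltn_pmul2l.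
have km : (k + 16 <= m)%N.
  by rewrite /m (addnC k) -addnA leq_add2l (leq_trans (ltnW kL)) ?leq_addr.
have mE : m = (m - k + k)%N by rewrite subnK // (leq_trans (leq_addr _ _) km).
have [||u [C [ru szC adv]]] := weak_predictor phi H mE mn _ _ gk.
- by rewrite ltn_subRL addnC (leq_trans _ km) // addnC ltn_add2l.
- by lra.
exists C; split=> //.
have := predictor_size_bound Ls L2L L2le (ltn0Sn _) kq erefl mE (leqnn _) ru.
move/(leq_trans (leq_mul szC (leqnn _))); rewrite -(ler_nat R) !natrM => sz.
have /andP[{}P0 _] := P0.
(* Multiplying by [24 * 2 ^ k * gamma ^ 2 >= 1] trades the factor [2 ^ k] of the size bound for
   [gamma ^ 2]. *)
apply: (@le_trans _ _ ((circuit_size C)%:R * (24 * (2 ^ k)%:R * gamma ^+ 2))).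
  by rewrite ler_peMr.
rewrite (_ : _ * (24 * _ * _) =
  24 * gamma ^+ 2 * ((circuit_size C)%:R * (2 ^ k)%:R)); last by ring.
apply: le_trans (ler_wpM2l _ sz) _; first by rewrite mulr_ge0 // ltW.
rewrite le_eqVlt; apply/orP; left; apply/eqP.
by ring.
Qed.
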